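(* For each $i=0,1$ let $G_i$ be a triangle-free $k$-regular super-$\lambda$ graph of order $n$, and let $\lambda'_i=\lambda'(G_i)$. Let $M$ be an arbitrary perfect matching between the vertices of $G_0$ and the vertices of $G_1$. If $\min\{n,\lambda'_0+\lambda'_1\}>3k-1$, then $G=G(G_0,G_1;M)$ is super-$\lambda''$ and $\rho'(G)=k$.
   Context: All graphs are finite and simple. For two graphs $G_0,G_1$ with the same number of vertices (on disjoint vertex-sets) and a perfect matching $M$ between $V(G_0)$ and $V(G_1)$ (i.e. the edges of $M$ realize a bijection $V(G_0)\to V(G_1)$), $G(G_0,G_1;M)$ is the graph with vertex-set $V(G_0)\cup V(G_1)$ and edge-set $E(G_0)\cup E(G_1)\cup M$. For a connected graph $G=(V,E)$ and an integer $h\geqslant 0$, a set $F\subseteq E(G)$ is an $h$-extra edge-cut if $G-F$ is disconnected and every component of $G-F$ has more than $h$ vertices. If such a set exists, $\lambda^{(h)}(G)$ is the minimum cardinality of an $h$-extra edge-cut, and $G$ is called $\lambda^{(h)}$-connected. A $\lambda^{(h)}$-cut is an $h$-extra edge-cut of cardinality $\lambda^{(h)}(G)$. Write $\lambda=\lambda^{(0)}$ (the edge-connectivity), $\lambda'=\lambda^{(1)}$ and $\lambda''=\lambda^{(2)}$. For $X\subset V(G)$, $d_G(X)$ is the number of edges between $X$ and $V(G)\setminus X$, and $\xi_h(G)=\min\{d_G(X): X\subset V(G),\ |X|=h+1,\ G[X]\text{ connected}\}$. A $\lambda^{(h)}$-connected graph $G$ is $\lambda^{(h)}$-optimal if $\lambda^{(h)}(G)=\xi_h(G)$,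 and it is super-$\lambda^{(h)}$ if it is $\lambda^{(h)}$-optimal and, for every $\lambda^{(h)}$-cut $F$ of $G$, some component of $G-F$ has exactly $h+1$ vertices. Super-$\lambda$, super-$\lambda'$ and super-$\lambda''$ are the cases $h=0,1,2$. A disconnected graph is not super-$\lambda^{(h)}$. For a super-$\lambda'$ graph $G$, the persistence $\rho'(G)$ is the maximum integer $m$ such that $G-F$ is still super-$\lambda'$ for every $F\subseteq E(G)$ with $|F|\leqslant m$. Any assertion about $\rho'(G)$ includes the assertion that $G$ is super-$\lambda'$. *)

(* Defs.v *)
From mathcomp Require Import all_boot.

Set Implicit Arguments.
Unset Strict Implicit.
Unset Printing Implicit Defensive.

Record sgraph := SGraph {
  vertex :> finType;
  adj : rel vertex;
  adj_sym : symmetric adj;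
  adj_irr : irreflexive adj
}.

Section Basic.
Variable G : sgraph.
Implicit Types (F : {set {set G}}) (X : {set G}).

Definition edges : {set {set G}} :=
  [set e | [exists x : G, exists y : G, adj x y && (e == [set x; y])]].

Definition del_adj F : rel G := [rel x y | adj x y && ([set x; y] \notin F)].

Lemma del_adj_sym F : symmetric (del_adj F).
Proof. by move=> x y; rewrite /del_adj /= adj_sym setUC. Qed.

Lemma del_adj_irr F : irreflexive (del_adj F).
Proof. by move=> x; rewrite /del_adj /= adj_irr. Qed.

(* The graph G - F. *)
Definition del_edges F : sgraph := SGraph (del_adj_sym F) (del_adj_irr F).

Definition induced_adj X : rel {x : G | x \in X} :=
  [rel u v | adj (val u) (val v)].

Lemma induced_adj_sym X : symmetric (@induced_adj X).
Proof. by move=> u v; apply: adj_sym. Qed.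

Lemma induced_adj_irr X : irreflexive (@induced_adj X).
Proof. by move=> u; apply: adj_irr. Qed.

(* The graph G[X]. *)
Definition induced X : sgraph :=
  SGraph (@induced_adj_sym X) (@induced_adj_irr X).

Definition connected : bool :=
  [forall x : G, forall y : G, connect (@adj G) x y].

Definition components : {set {set G}} :=
  equivalence_partition (connect (@adj G)) [set: G].

Definition regular (k : nat) : Prop :=
  forall x : G, #|[set y | adj x y]| = k.

Definition triangle_free : Prop :=
  forall x y z : G, ~~ [&& adj x y, adj y z & adj z x].

(* d_G(X) *)
Definition boundary_size X : nat :=
  #|[set e in edges | (e :&: X != set0) && (e :\: X != set0)]|.

End Basic.

Definition extra_edge_cut (h : nat) (G : sgraph) (F : {set {set G}}) : bool :=
  [&& F \subset edges G,
      ~~ connected (del_edges F)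
    & [forall C in components (del_edges F), h < #|C| ]].

Definition lambda_connected (h : nat) (G : sgraph) : bool :=
  connected G && [exists F : {set {set G}}, extra_edge_cut h F].

(* The default value #|edges G| bounds every cut from above, so it never
   lowers the minimum; it is reached by convention when there is no cut. *)
Definition lambda (h : nat) (G : sgraph) : nat :=
  \big[minn/#|edges G|]_(F : {set {set G}} | extra_edge_cut h F) #|F|.

(* Same convention: boundary_size X <= #|edges G|. *)
Definition xi (h : nat) (G : sgraph) : nat :=
  \big[minn/#|edges G|]_(X : {set G} |
      [&& X \proper [set: G], #|X| == h.+1 & connected (induced X)])
    boundary_size X.

Definition lambda_optimal (h : nat) (G : sgraph) : bool :=
  lambda_connected h G && (lambda h G == xi h G).

Definition super_lambda (h : nat) (G : sgraph) : bool :=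
  lambda_optimal h G &&
  [forall F : {set {set G}},
     extra_edge_cut h F && (#|F| == lambda h G) ==>
     [exists C in components (del_edges F), #|C| == h.+1]].

Definition fault_tolerant (G : sgraph) (m : nat) : Prop :=
  forall F : {set {set G}},
    F \subset edges G -> #|F| <= m -> super_lambda 1 (del_edges F).

(* rho'(G) = m.  Such an m exists exactly when G is super-lambda': the edgeless
   graph is not super-lambda', so fault_tolerant G fails for m >= #|edges G|. *)
Definition persistence_eq (G : sgraph) (m : nat) : Prop :=
  [/\ super_lambda 1 G,
      fault_tolerant G m
    & forall m' : nat, fault_tolerant G m' -> m' <= m].

Section MatchingGraph.
Variables (G0 G1 : sgraph) (M : G0 -> G1).

Definition matching_adj : rel (G0 + G1)%type := fun u v =>
  match u, v with
  | inl x, inl y => adj x y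
  | inr x, inr y => adj x y
  | inl x, inr y => M x == y
  | inr y, inl x => M x == y
  end.

Lemma matching_adj_sym : symmetric matching_adj.
Proof. by move=> [x|x] [y|y] //=; apply: adj_sym. Qed.

Lemma matching_adj_irr : irreflexive matching_adj.
Proof. by move=> [x|x] /=; apply: adj_irr. Qed.

(* G(G0, G1; M), the perfect matching being { x -- M x } for a bijection M. *)
Definition matching_graph : sgraph :=
  SGraph matching_adj_sym matching_adj_irr.

End MatchingGraph.

(* Main.v *)
Require Import Defs.
From mathcomp Require Import all_boot.
From mathcomp Require Import zify.

(* All cuts that matter are boundaries.  If F is an h-extra edge-cut and C a
   component of G - F, the boundary of C lies in F and is again an h-extra
   edge-cut, so super-lambda^(h) reduces to lower bounds on boundaries d(X).

   In a triangle-free r-regular graph, Mantel's theorem gives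
   2 d(X) >= 2 r |X| - |X|^2.  In each G_i this yields lambda'_i <= 2k - 2, so
   lambda'_0 + lambda'_1 >= 3k forces k >= 4 and lambda'_i >= k + 2; moreover
   d(Y) >= lambda'_i as soon as Y and its complement have two vertices.  If X
   meets the two sides in X_0 and X_1, then
   d_G(X) >= d_{G_0}(X_0) + d_{G_1}(X_1) + ||X_0| - |X_1||, and a case analysis
   on the sizes of the X_i gives d_G(X) >= 3k > 3k - 1 = xi_2(G) whenever X and
   its complement have at least four vertices.

   For |F| <= k, such boundaries keep at least 3k - |F| edges in G - F, more
   than the smallest edge degree of G - F.  A set of three vertices spans a path
   x - y - z, and a 3-set whose boundary is as small as every edge degree would
   have deg x, deg z <= 2 in G - F, which needs more than k deletions.  Removing
   the k + 1 edges at one vertex disconnects G, so k is the exact value. *)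

Set Implicit Arguments.
Unset Strict Implicit.
Unset Printing Implicit Defensive.

(** * Edge boundaries *)

Lemma bigminn_le (I : finType) (P : pred I) (f : I -> nat) d i :
  P i -> \big[minn/d]_(j | P j) f j <= f i.
Proof.
rewrite -big_filter => Pi.
have : i \in [seq j <- index_enum I | P j] by rewrite mem_filter Pi mem_index_enum.
elim: [seq j <- _ | _] => // j s IH; rewrite inE big_cons geq_min.
by case/predU1P=> [<-|/IH ->]; rewrite ?leqnn ?orbT.
Qed.

Lemma bigminn_ge (I : finType) (P : pred I) (f : I -> nat) d c :
  c <= d -> (forall i, P i -> c <= f i) -> c <= \big[minn/d]_(j | P j) f j.
Proof. by move=> cd cf; elim/big_ind: _ => // a b ca cb; rewrite leq_min ca. Qed.

Lemma set2_inj (T : finType) (x y x' y' : T) :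
  [set x; y] = [set x'; y'] -> (x = x' /\ y = y') \/ (x = y' /\ y = x').
Proof.
move=> E; have := set21 x y; have := set22 x y; rewrite E => /set2P yE /set2P xE.
have := set21 x' y'; have := set22 x' y'; rewrite -E => /set2P yE' /set2P xE'.
by intuition congruence.
Qed.

Lemma connect_step (T : finType) (e : rel T) x y :
  connect e x y -> x != y -> exists z, e x z.
Proof.
case/connectP=> [[|z p]] /=; first by move=> _ -> /eqP.
by case/andP=> exz _ _ _; exists z.
Qed.

Section Graph.
Variable G : sgraph.
Implicit Types (X Y C : {set G}) (F : {set {set G}}).

(** The edge set that [boundary_size] counts, named so that it can itself serve as a cut. *)
Definition bnd X : {set {set G}} :=
  [set e in edges G | (e :&: X != set0) && (e :\: X != set0)].

Definition deg (x : G) := #|[set y | adj x y]|.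

Lemma in_edges (x y : G) : ([set x; y] \in edges G) = adj x y.
Proof.
rewrite inE; apply/existsP/idP => [[a /existsP[b /andP[ab /eqP/set2_inj]]]|xy].
  by case=> -[-> ->] //; rewrite adj_sym.
by exists x; apply/existsP; exists y; rewrite xy eqxx.
Qed.

Lemma edgesP (e : {set G}) :
  e \in edges G -> exists x y : G, adj x y /\ e = [set x; y].
Proof.
by rewrite inE => /existsP[x /existsP[y /andP[xy /eqP ->]]]; exists x, y.
Qed.

Lemma in_bnd X (x y : G) :
  ([set x; y] \in bnd X) = adj x y && ((x \in X) (+) (y \in X)).
Proof.
rewrite !in_set -in_edges inE; congr (_ && _).
have -> : ([set x; y] :&: X != set0) = (x \in X) || (y \in X).
  apply/set0Pn/orP => [[z]|[]]; last by exists y; rewrite !inE eqxx orbT.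
    by rewrite !inE => /andP[/pred2P[]-> ->]; [left|right].
  by exists x; rewrite !inE eqxx.
have -> : ([set x; y] :\: X != set0) = (x \notin X) || (y \notin X).
  apply/set0Pn/orP => [[z]|[]]; last by exists y; rewrite !inE eqxx orbT andbT.
    by rewrite !inE => /andP[zX /pred2P[]E]; rewrite -E; [left|right].
  by exists x; rewrite !inE eqxx andbT.
by case: (x \in X); case: (y \in X).
Qed.

Lemma bnd_edges X : bnd X \subset edges G.
Proof. by apply/subsetP=> e; rewrite inE => /andP[]. Qed.

Lemma bndP X (e : {set G}) : e \in bnd X ->
  exists x y : G, [/\ adj x y, x \in X, y \notin X & e = [set x; y]].
Proof.
move=> eX; have [x [y [xy E]]] := edgesP (subsetP (bnd_edges X) _ eX).
move: eX; rewrite E in_bnd xy /=; case: (boolP (x \in X)) => xX /= yX.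
  by exists x, y.
by exists y, x; rewrite adj_sym setUC.
Qed.

Lemma bndC X : bnd (~: X) = bnd X.
Proof.
apply/setP=> e; rewrite !inE; congr (_ && _); rewrite andbC.
by rewrite -!setDE setDE setCK.
Qed.

(** * Degree counting and Mantel's theorem *)

Lemma bnd_sum X :
  #|bnd X| = \sum_(x in X) #|[set y | adj x y & y \notin X]|.
Proof.
pose P := [set p : G * G | [&& p.1 \in X, p.2 \notin X & adj p.1 p.2]].
have -> : bnd X = [set [set p.1; p.2] | p in P].
  apply/setP=> e; apply/idP/imsetP => [/bndP[x [y [xy xX yX ->]]]|[[x y]]].
    by exists (x, y); rewrite // inE /= xX yX.
  by rewrite inE /= => /and3P[xX yX xy] ->; rewrite in_bnd xy xX (negPf yX).
(* X orients each boundary edge, so an unordered pair has only one preimage. *)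
rewrite card_in_imset; last first.
  move=> [x y] [x' y']; rewrite !inE /= => /and3P[xX yX _] /and3P[xX' yX' _].
  by case/set2_inj=> -[E E']; [rewrite E E' | rewrite -E xX in yX'].
rewrite -sum1dep_card.
under [RHS]eq_bigr do rewrite -sum1dep_card.
rewrite pair_big_dep /=; apply: eq_bigl => -[x y] /=.
by rewrite andbC -andbA; case: (adj x y); rewrite ?andbT ?andbF //= andbC.
Qed.

(** Each edge of G[X] is counted twice. *)
Definition inner X : nat := \sum_(x in X) #|[set y in X | adj x y]|.

Lemma bnd_inner X : #|bnd X| + inner X = \sum_(x in X) deg x.
Proof.
rewrite bnd_sum -big_split /=; apply: eq_bigr => x xX.
rewrite /deg -(cardsID X [set y | adj x y]) addnC; congr (_ + _); apply: eq_card => y.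
  by rewrite !inE andbC.
by rewrite !inE andbC.
Qed.

(** Let [x] have the most neighbours in X and let N be the set of these. N is independent, so its
    degree sum counts only edges to the rest of X; it is at most the degree sum there, which is at
    most |X - N| |N|. Hence [inner X] is at most 2 |N| |X - N|, and AM-GM concludes. *)
Lemma mantel X : triangle_free G -> 2 * inner X <= #|X| ^ 2.
Proof.
move=> tf; have [->|[x0 x0X]] := set_0Vmem X; first by rewrite /inner big_set0.
pose d (x : G) := #|[set y in X | adj x y]|.
case: (@arg_maxnP G x0 (mem X) d x0X) => x xX xmax.
pose N := [set y in X | adj x y].
have NX : N \subset X by apply/subsetP=> y; rewrite inE => /andP[].
have indep y z : y \in N -> z \in N -> ~~ adj y z.
  rewrite !inE => /andP[_ xy] /andP[_ xz]; apply/negP=> yz.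
  by have := tf x y z; rewrite xy yz adj_sym xz.
have SN : \sum_(y in N) d y <= \sum_(z in X :\: N) d z.
  have -> : \sum_(y in N) d y = \sum_(y in N) \sum_(z in X :\: N) adj y z.
    apply: eq_bigr => y yN; rewrite -big_mkcondr /= sum1dep_card; apply: eq_card => z.
    rewrite 2!in_set in_setD; case: (boolP (z \in N)) => //=.
    by move=> zN; rewrite (negPf (indep _ _ yN zN)) andbF.
  rewrite exchange_big /=; apply: leq_sum => z _.
  rewrite -big_mkcondr /= sum1dep_card; apply: subset_leq_card.
  apply/subsetP=> y; rewrite !in_set (adj_sym y z) => /andP[/andP[-> _] ->] //.
have SD : \sum_(z in X :\: N) d z <= #|X :\: N| * #|N|.
  rewrite -sum_nat_const; apply: leq_sum => z /setDP[zX _]; exact: xmax.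
have -> : inner X = \sum_(y in N) d y + \sum_(z in X :\: N) d z.
  rewrite /inner (big_setID N) /=; congr (_ + _).
  by rewrite (setIidPr NX).
rewrite -(cardsID N X) (setIidPr NX).
have [AGM _] := nat_AGM2 #|N| #|X :\: N|; move: SN SD.
move: (\sum_(y in N) d y) (\sum_(z in X :\: N) d z) => S1 S2 le12 le2.
apply: leq_trans AGM; rewrite mulnDr (mulnC #|N|) -[4]/(2 + 2) mulnDl.
by apply: leq_add; rewrite leq_mul2l // (leq_trans le12).
Qed.

Lemma bnd_regular_ge r X : triangle_free G -> regular G r ->
  2 * (r * #|X|) <= 2 * #|bnd X| + #|X| ^ 2.
Proof.
move=> tf rg; have := bnd_inner X.
under eq_bigr do rewrite /deg rg.
by rewrite sum_nat_const; have := mantel X tf; lia.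
Qed.

Lemma adj_neq (x y : G) : adj x y -> x != y.
Proof. by apply: contraTneq => ->; rewrite adj_irr. Qed.

Lemma bnd_pair (x y : G) : adj x y -> (#|bnd [set x; y]|).+2 = deg x + deg y.
Proof.
move=> xy; have nxy := adj_neq xy.
have := bnd_inner [set x; y]; rewrite /inner !big_setU1 ?inE //= !big_set1.
have -> : [set z in [set x; y] | adj x z] = [set y].
  apply/setP=> z; rewrite !inE.
  by case: eqP => [->|_] /=; [rewrite adj_irr (negPf nxy)|case: eqP => [->|]].
have -> : [set z in [set x; y] | adj y z] = [set x].
  apply/setP=> z; rewrite !inE.
  case: eqP => [->|_] /=; first by rewrite adj_sym xy.
  by case: eqP => [->|]; rewrite ?adj_irr.
by rewrite !cards1; lia.
Qed.

Lemma bnd1 (x : G) : #|bnd [set x]| = deg x.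
Proof.
have := bnd_inner [set x]; rewrite /inner !big_set1.
suff -> : [set y in [set x] | adj x y] = set0 by rewrite cards0 addn0.
by apply/setP=> y; rewrite !inE; case: eqP => // ->; rewrite adj_irr.
Qed.

Lemma connected_bnd_gt0 :
  (forall X, X != set0 -> X != setT -> 0 < #|bnd X|) -> connected G.
Proof.
move=> h; apply/forallP=> x; apply/forallP=> y; apply/negPn/negP => nxy.
pose X := [set z | connect (@adj G) x z].
have /card_gt0P[e /bndP[a [b [ab]]]] : 0 < #|bnd X|.
  apply: h; first by apply/set0Pn; exists x; rewrite inE.
  by apply/eqP=> XT; move/negP: nxy; apply; have := in_setT y; rewrite -XT inE.
rewrite !inE => xa /negP[]; exact: connect_trans xa (connect1 ab).
Qed.

Lemma connected_deg (x y : G) : connected G -> x != y -> exists z, adj x z.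
Proof. by move=> /forallP/(_ x)/forallP/(_ y)/connect_step. Qed.

(** * Extra edge-cuts and super-connectivity criteria *)

(** Typed over G rather than [del_edges F], so that components for different F can be compared. *)
Definition comp F (x : G) : {set G} := [set y | connect (del_adj F) x y].

Lemma del_connect_sym F : connect_sym (del_adj F).
Proof. exact/sym_connect_sym/del_adj_sym. Qed.

Lemma mem_components F C :
  reflect (exists x, C = comp F x) (C \in components (del_edges F)).
Proof.
apply: (iffP imsetP) => [[x _ ->]|[x ->]]; exists x; rewrite ?inE //.
  by apply/setP=> y; rewrite !inE.
by apply/setP=> y; rewrite !inE.
Qed.

Lemma disconnectedP F :
  reflect (exists x y, y \notin comp F x) (~~ connected (del_edges F)).
Proof.
rewrite negb_forall; apply: (iffP existsP) => -[x].
  by rewrite negb_forall => /existsP[y xy]; exists x, y; rewrite inE.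
by case=> y; rewrite inE => xy; exists x; rewrite negb_forall; apply/existsP; exists y.
Qed.

Lemma extra_cut_intro h F x y : F \subset edges G -> y \notin comp F x ->
  (forall z, h < #|comp F z|) -> extra_edge_cut h F.
Proof.
move=> FE xy hC; apply/and3P; split=> //; first by apply/disconnectedP; exists x, y.
by apply/forallP=> C; apply/implyP=> /mem_components[z ->].
Qed.

Lemma extra_cut_elim h F : extra_edge_cut h F ->
  [/\ F \subset edges G, exists x y, y \notin comp F x & forall z, h < #|comp F z|].
Proof.
case/and3P=> FE /disconnectedP xy /forallP hC; split=> // z.
by have /implyP := hC (comp F z); apply; apply/mem_components; exists z.
Qed.

Lemma comp_refl F x : x \in comp F x.
Proof. by rewrite inE. Qed.

(** Every edge out of C is deleted, so no walk of G - F leaves C. *)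
Lemma comp_closed F C x : bnd C \subset F -> x \in C -> comp F x \subset C.
Proof.
move=> CF xC; apply/subsetP=> y; rewrite inE => /connectP[p].
elim: p x xC => [|z p IH] x xC /=; first by move=> _ ->.
case/andP=> /andP[xz nF] /IH IHp; apply: IHp.
apply: contraNT nF => zC; apply: (subsetP CF).
by rewrite in_bnd xz xC (negPf zC).
Qed.

Lemma bnd_comp F x : bnd (comp F x) \subset F.
Proof.
apply/subsetP=> e /bndP[a [b [ab]]]; rewrite !inE => xa xb ->.
apply: contraNT xb => nF; apply: connect_trans xa _.
by apply: connect1; rewrite /del_adj /= ab.
Qed.

Lemma comp_sub F F' x : F \subset F' -> comp F' x \subset comp F x.
Proof.
move=> sF; apply/subsetP=> y; rewrite !inE; apply: connect_sub => a b /andP[ab nF].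
by apply: connect1; rewrite /del_adj /= ab; apply: contraNN nF; apply: (subsetP sF).
Qed.

(** The new cut is contained in F, so components only grow, while [comp F x] stays separated from
    the rest. *)
Lemma extra_cut_comp h F x : extra_edge_cut h F ->
  extra_edge_cut h (bnd (comp F x)).
Proof.
move=> /extra_cut_elim[FE [a [b ab]] hC].
have [y xy] : exists y, y \notin comp F x.
  have [xa|] := boolP (a \in comp F x); last by exists a.
  exists b; apply: contra ab; rewrite !inE in xa *; apply: connect_trans.
  by rewrite del_connect_sym.
apply: (@extra_cut_intro _ _ x y); rewrite ?bnd_edges //.
  by apply: contra xy; apply: subsetP; apply: comp_closed; rewrite ?comp_refl.
by move=> z; apply: leq_trans (hC z) (subset_leq_card (comp_sub _ (bnd_comp F x))).
Qed.

(** Every component lies on one side of X, and both sides are nonempty because an empty boundary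
    would leave G connected. *)
Lemma extra_cut_bnd_card h X : connected G -> extra_edge_cut h (bnd X) ->
  h < #|X| /\ h < #|~: X|.
Proof.
move=> cG /extra_cut_elim[_ [x [y xy]] hC].
have side Y a : bnd Y = bnd X -> a \in Y -> h < #|Y|.
  move=> E aY; apply: leq_trans (hC a) (subset_leq_card _).
  by apply: comp_closed => //; rewrite E.
have noempty Y : bnd Y = bnd X -> Y != set0.
  move=> E; apply/eqP=> Y0; move/negP: xy; apply.
  suff bX0 : bnd X = set0.
    rewrite inE (eq_connect (e' := @adj G)); last first.
      by move=> a b; rewrite /del_adj /= bX0 in_set0 andbT.
    by move/forallP/(_ x)/forallP/(_ y): cG.
  by rewrite -E Y0; apply/setP=> e; rewrite !inE setI0 eqxx andbF.
have [] := (set0Pn _ (noempty X erefl), set0Pn _ (noempty (~: X) (bndC X))).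
by move=> [a aX] [b bX]; split; [apply: side aX|apply: side bX; apply: bndC].
Qed.

(** For a cut F, a component C of G - F and its complement both have more than h vertices. If one of
    them has exactly h+1, the weak bound applies and that side is itself a component; otherwise the
    strict bound excludes |F| = d(X0). *)
Lemma super_lambda_criterion h X0 :
  connected G -> #|X0| = h.+1 -> connected (induced X0) ->
  extra_edge_cut h (bnd X0) ->
  (forall X, #|X| = h.+1 -> connected (induced X) -> #|bnd X0| <= #|bnd X|) ->
  (forall X, #|X| = h.+1 -> extra_edge_cut h (bnd X) -> #|bnd X0| <= #|bnd X|) ->
  (forall X, h.+1 < #|X| -> h.+1 < #|~: X| -> extra_edge_cut h (bnd X) ->
     #|bnd X0| < #|bnd X|) ->
  super_lambda h G.
Proof.
move=> cG hX0 cX0 cut0 Hconn Hcut Hbig.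
have [_ hX0c] := extra_cut_bnd_card cG cut0.
have prop0 : X0 \proper setT.
  by rewrite properT; apply: contraTneq hX0c => ->; rewrite setCT cards0.
have ext F : extra_edge_cut h F -> #|bnd X0| <= #|F| /\
    (#|F| = #|bnd X0| -> exists2 C, C \in components (del_edges F) & #|C| = h.+1).
  move=> cF; have [FE [x [y xy]] hC] := extra_cut_elim cF.
  pose C := comp F x; have cC := extra_cut_comp x cF.
  have leF : #|bnd C| <= #|F| := subset_leq_card (bnd_comp F x).
  have [hC1 hC2] := extra_cut_bnd_card cG cC.
  have [E|neC] := eqVneq #|C| h.+1.
    split; first exact: leq_trans (Hcut _ E cC) leF.
    by move=> _; exists C => //; apply/mem_components; exists x.
  have [E|neC'] := eqVneq #|~: C| h.+1; last first.
    suff lt : #|bnd X0| < #|bnd C|.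
      split; first exact: leq_trans (ltnW lt) leF.
      by move=> E; move: (leq_trans lt leF); rewrite E ltnn.
    by apply: Hbig; rewrite // ltn_neqAle eq_sym ?neC ?neC'.
  split; first by apply: leq_trans leF; rewrite -(bndC C); apply: Hcut; rewrite ?bndC.
  (* The component of [y] fills the complement of C: it lies inside and has more than h vertices. *)
  move=> _; exists (~: C) => //; apply/mem_components; exists y.
  apply/esym/eqP; rewrite eqEcard E hC andbT; apply: comp_closed; rewrite ?bndC ?in_setC //.
  exact: bnd_comp.
(* Keeps the default value of both minima from falling below [#|bnd X0|]. *)
have leE : #|bnd X0| <= #|edges G| := subset_leq_card (bnd_edges X0).
have xiE : xi h G = #|bnd X0|.
  apply/eqP; rewrite eqn_leq; apply/andP; split.
    by apply: (@bigminn_le _ _ (fun X => boundary_size X)); rewrite prop0 hX0 eqxx.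
  by apply: bigminn_ge => // X /and3P[_ /eqP hX cX]; apply: Hconn.
have laE : lambda h G = #|bnd X0|.
  apply/eqP; rewrite eqn_leq; apply/andP; split.
    exact: (bigminn_le (fun F : {set {set G}} => #|F|)).
  by apply: bigminn_ge => // F' /ext[].
rewrite /super_lambda /lambda_optimal /lambda_connected cG laE xiE eqxx andbT.
apply/andP; split; first by apply/existsP; exists (bnd X0).
apply/forallP=> F; apply/implyP=> /andP[/ext[_ hF] /eqP/hF[C C1 C2]].
by apply/existsP; exists C; rewrite C1 C2 eqxx.
Qed.

Lemma induced_star_connected X y : y \in X ->
  (forall x, x \in X -> x != y -> adj y x) -> connected (induced X).
Proof.
move=> yX star; pose y' : induced X := Sub y yX.
have cy (u : induced X) : connect (@adj (induced X)) y' u.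
  have [->|ne] := eqVneq u y'; first exact: connect0.
  by apply: connect1; apply: star; [apply: valP | rewrite -(inj_eq val_inj) in ne].
apply/forallP=> u; apply/forallP=> v; apply: connect_trans (cy v).
by rewrite sym_connect_sym //; apply: adj_sym.
Qed.

Lemma comp_card_nbrs h X w :
  h <= #|[set y | adj w y & (y \in X) == (w \in X)]| -> h < #|comp (bnd X) w|.
Proof.
set N := [set y | _] => hN; have wN : w \notin N by rewrite inE adj_irr.
apply: leq_ltn_trans hN _; rewrite -add1n; have <- : #|w |: N| = 1 + #|N|.
  by rewrite cardsU1 wN.
apply: subset_leq_card; rewrite subUset sub1set comp_refl; apply/subsetP=> y.
rewrite !inE => /andP[wy /eqP E]; apply: connect1.
by rewrite /del_adj /= wy in_bnd wy E addbb.
Qed.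

(** * 1-extra edge-cuts in triangle-free graphs *)

Lemma lambda_le h F : extra_edge_cut h F -> lambda h G <= #|F|.
Proof. exact: (bigminn_le (fun F : {set {set G}} => #|F|)). Qed.

Lemma extra_cut_nbr h X w : 0 < h -> extra_edge_cut h (bnd X) ->
  exists y, adj w y /\ (y \in X) = (w \in X).
Proof.
move=> h0 /extra_cut_elim[_ _ /(_ w) hw].
have /card_gt1P[a [b [aC bC nab]]] := leq_ltn_trans h0 hw.
have [c cC wc] : exists2 c, c \in comp (bnd X) w & w != c.
  by have [E|ne] := eqVneq w a; [exists b => //; rewrite E | exists a].
rewrite inE in cC; have [y /andP[wy]] := connect_step cC wc.
rewrite in_bnd wy /= negb_add => /eqP E; exists y; split=> //.
Qed.

(** For h = 1 the size condition only says that no vertex gets isolated; [extra_cut_nbr] is the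
    converse. *)
Lemma extra_cut1_intro X x y : x \in X -> y \notin X ->
  (forall w, exists z, adj w z /\ (z \in X) = (w \in X)) ->
  extra_edge_cut 1 (bnd X).
Proof.
move=> xX yX nbr; apply: (@extra_cut_intro _ _ x y); rewrite ?bnd_edges //.
  by apply: contra yX; apply: subsetP; apply: comp_closed.
move=> w; apply: comp_card_nbrs; have [z [wz zw]] := nbr w.
by apply/card_gt0P; exists z; rewrite inE wz zw eqxx.
Qed.

Lemma subset_out X : #|X| < #|G| -> exists y, y \notin X.
Proof.
move=> lt; have /card_gt0P[y] : 0 < #|~: X| by have := cardsC X; lia.
by rewrite inE; exists y.
Qed.

(* In a triangle-free graph the two ends of an edge can only isolate a pendant
   vertex. *)
Lemma extra_cut_edge (u v : G) :
  triangle_free G -> 2 < #|G| -> (forall x : G, 0 < deg x) -> adj u v ->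
  (forall w a b, adj w a -> adj a b -> w != b -> [set a; b] = [set u; v] ->
     deg w != 1) ->
  extra_edge_cut 1 (bnd [set u; v]).
Proof.
move=> tf G2 deg0 uv pend; set X := [set u; v].
have [y yX] : exists y, y \notin X.
  by apply: subset_out; rewrite cards2 (adj_neq uv).
apply: (@extra_cut1_intro X u y) => //; first by rewrite !inE eqxx.
move=> w; have [wX|wX] := boolP (w \in X).
  by case/set2P: wX => ->; [exists v | exists u]; rewrite ?(adj_sym v) !inE eqxx ?orbT.
have [z /andP[wz zX]|all] := pickP [pred z | adj w z & z \notin X].
  by exists z; split=> //; apply: negPf.
have nX z : adj w z -> z \in X by move=> wz; have := all z; rewrite /= wz => /negbFE.
have /card_gt0P[z] := deg0 w; rewrite inE => wz; exfalso.
(* All neighbours of [w] lie in X although [w] does not; adjacency to both ends would give a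
   triangle, so [w] is pendant, against [pend]. *)
have key a b : adj a b -> adj w a -> [set a; b] = X -> False.
  move=> ab wa E.
  have wb : w != b by apply: contraNneq wX => ->; rewrite -E set22.
  have /negP[] := pend w a b wa ab wb E.
  have wnb : ~~ adj w b by have := tf w a b; rewrite wa ab /= adj_sym.
  apply/cards1P; exists a; apply/setP=> c; rewrite !inE.
  apply/idP/eqP => [wc|-> //].
  by have := nX c wc; rewrite -E => /set2P[] // E'; rewrite -E' wc in wnb.
have zX := nX z wz; case/set2P: zX wz => -> wz; first exact: (key u v).
by apply: (key v u) => //; [rewrite adj_sym | rewrite setUC].
Qed.

(** The boundary of any edge is a witness: a pendant vertex would force r = 1, but its neighbour on
    that edge has degree at least 2. *)
Lemma regular_lambda1_le r : triangle_free G -> regular G r -> 0 < r -> 2 < #|G| ->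
  lambda 1 G <= 2 * r - 2.
Proof.
move=> tf rg r0 G2.
have /card_gt0P[u _] : 0 < #|G| by lia.
have /card_gt0P[v] : 0 < #|[set v | adj u v]| by rewrite rg.
rewrite inE => uv; have buv := bnd_pair uv; rewrite /deg !rg in buv.
suff cut : extra_edge_cut 1 (bnd [set u; v]).
  by apply: leq_trans (lambda_le cut) _; lia.
apply: extra_cut_edge => // [x|w a b wa ab wb _]; first by rewrite /deg rg.
rewrite /deg rg -(rg a) eq_sym; apply/eqP=> a1.
suff : 1 < #|[set y | adj a y]| by rewrite -a1.
by apply/card_gt1P; exists w, b; rewrite !inE adj_sym.
Qed.

(* Moving a vertex without neighbours on its own side across the cut lowers the
   boundary, so a minimal such X defines a 1-extra edge-cut. *)
Lemma bnd_ge_lambda1 r X : triangle_free G -> regular G r -> 0 < r -> 2 < #|G| ->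
  1 < #|X| -> 1 < #|~: X| -> lambda 1 G <= #|bnd X|.
Proof.
move=> tf rg r0 G2; have [m] := ubnP #|bnd X|; elim: m X => // m IH X.
rewrite ltnS => leX X1 X1'.
have [/existsP[v /forallP iso]|] :=
  boolP [exists v, forall y, adj v y ==> ((y \in X) != (v \in X))]; last first.
  rewrite negb_exists => /forallP nbr.
  have /card_gt0P[x xX] := ltnW X1; have /card_gt0P[y yX] := ltnW X1'.
  apply: lambda_le; apply: (extra_cut1_intro xX (y := y)); first by rewrite inE in yX.
  move=> w; have := nbr w; rewrite negb_forall => /existsP[z].
  by rewrite negb_imply negbK => /andP[wz /eqP]; exists z.
(* Y is the side containing [v]: X or its complement. *)
have move_v Y : bnd Y = bnd X -> 1 < #|Y| -> 1 < #|~: Y| -> v \in Y ->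
    (forall y, adj v y -> y \notin Y) -> lambda 1 G <= #|bnd X|.
  move=> EY Y1 Y1' vY isoY; rewrite -EY.
  (* A side of two vertices cannot shrink further, but Mantel already gives it 2r - 2 boundary
     edges. *)
  have [Y2|Y2] := leqP #|Y| 2.
    apply: leq_trans (regular_lambda1_le tf rg r0 G2) _.
    have := bnd_regular_ge Y tf rg; have -> : #|Y| = 2 by lia.
    lia.
  have cY : #|Y :\ v|.+1 = #|Y| by rewrite (cardsD1 v Y) vY.
  (* As [v] has no neighbour in Y, removing it creates no boundary edge and drops all edges at
     [v]. *)
  have lt : bnd (Y :\ v) \proper bnd Y.
    apply/properP; split.
      apply/subsetP=> e /bndP[x [y [xy]]].
      rewrite !in_setD1 => /andP[xv xY] yY ->; rewrite in_bnd xy xY /=.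
      move: yY; rewrite negb_and negbK; case/orP=> // /eqP E.
      by have := isoY x; rewrite xY adj_sym -E xy => /(_ isT).
    have /card_gt0P[u] : 0 < #|[set u | adj v u]| by rewrite rg.
    rewrite inE => vu; exists [set v; u]; first by rewrite in_bnd vu vY (negPf (isoY u vu)).
    by rewrite in_bnd vu !in_setD1 eqxx (negPf (isoY u vu)) andbF.
  have ltc := proper_card lt.
  apply: leq_trans (ltnW ltc); apply: IH.
  - by apply: leq_trans ltc _; rewrite EY.
  - by rewrite -ltnS cY.
  - apply: leq_trans Y1' (subset_leq_card _); rewrite setCS; apply: subsetDl.
have [vX|vX] := boolP (v \in X).
  apply: (move_v X) => // y vy; have := iso y; rewrite vy vX /=.
  by case: (y \in X).
apply: (move_v (~: X)); rewrite ?bndC ?setCK ?inE // => y vy.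
by have := iso y; rewrite vy (negPf vX) inE negbK /=; case: (y \in X).
Qed.

Lemma connected_pair X : #|X| = 2 -> connected (induced X) ->
  exists u v, adj u v /\ X = [set u; v].
Proof.
move=> /eqP/cards2P[u [v [uv EX]]] cX.
have uX : u \in X by rewrite EX set21.
have vX : v \in X by rewrite EX set22.
pose u' : induced X := Sub u uX; pose v' : induced X := Sub v vX.
have /connect_step/(_ uv)[z] : connect (@adj (induced X)) u' v'.
  by move/forallP/(_ u')/forallP/(_ v'): cX.
rewrite /= /induced_adj /= => uz; exists u, v; split=> //.
have : sval z \in [set u; v] by rewrite -EX; apply: valP.
by move: (sval z) uz => a ua /set2P[] E; rewrite E ?adj_irr in ua.
Qed.

Lemma extra_cut_pair X : #|X| = 2 -> extra_edge_cut 1 (bnd X) ->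
  exists u v, adj u v /\ X = [set u; v].
Proof.
move=> /eqP/cards2P[u [v [uv EX]]] cX.
have [y [uy]] := extra_cut_nbr u (ltn0Sn _) cX; rewrite {2}EX set21 EX => /set2P[] E.
  by rewrite E adj_irr in uy.
by exists u, v; rewrite -E.
Qed.

(** An edge inside X leaves one vertex, whose neighbour is an end of that edge and becomes the
    middle of the path. *)
Lemma path3 X : #|X| = 3 ->
  (forall w, w \in X -> exists2 y, adj w y & y \in X) ->
  exists x y z, [/\ adj x y, adj y z, x != z & X = [set x; y; z]].
Proof.
move=> X3 nbr; have /card_gt0P[x xX] : 0 < #|X| by rewrite X3.
have [y xy yX] := nbr x xX; have nxy := adj_neq xy.
have : 0 < #|X :\: [set x; y]|.
  have := cardsID [set x; y] X; have := subset_leq_card (subsetIr X [set x; y]).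
  rewrite cards2 nxy X3; lia.
case/card_gt0P=> z; rewrite !inE negb_or => /andP[/andP[zx zy] zX].
have EX : X = [set x; y; z].
  apply/esym/eqP; rewrite eqEcard; apply/andP; split.
    by rewrite !subUset !sub1set xX yX zX.
  by rewrite X3 -setUA cardsU1 cards2 !inE negb_or nxy eq_sym zx eq_sym zy.
have [w zw] := nbr z zX; rewrite {1}EX !inE -orbA => /or3P[]/eqP E; subst w.
- exists y, x, z; rewrite adj_sym xy adj_sym zw eq_sym zy; split=> //.
  by rewrite EX (setUC [set x]).
- by exists x, y, z; rewrite xy adj_sym zw eq_sym zx.
- by rewrite adj_irr in zw.
Qed.

(** The witness is an edge with the smallest boundary. The degree condition keeps this boundary from
    isolating a vertex and makes 3-sets strictly worse; the last hypothesis does the same for larger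
    sets. *)
Lemma super_lambda1_criterion :
  connected G -> triangle_free G -> 2 < #|G| ->
  (forall x y z : G, adj x y -> adj y z -> x != z -> 4 < deg x + deg z) ->
  (forall X, 3 < #|X| -> 3 < #|~: X| ->
     exists u v : G, adj u v /\ deg u + deg v < #|bnd X| + 2) ->
  super_lambda 1 G.
Proof.
move=> cG tf G2 Hdeg Hbig.
have nb x : exists y : G, adj x y.
  have [y] : exists y, y \notin [set x] by apply: subset_out; rewrite ?cards1 //; lia.
  by rewrite inE eq_sym => /(connected_deg cG).
have /card_gt0P[x0 _] : 0 < #|G| by lia.
have [y0 xy0] := nb x0.
case: (@arg_minnP (G * G)%type (x0, y0) (fun p => adj p.1 p.2)
        (fun p => #|bnd [set p.1; p.2]|) xy0) => -[u v] /= uv umin.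
have pmin (a b : G) : adj a b -> deg u + deg v <= deg a + deg b.
  by move=> ab; have := umin (a, b) ab; have := bnd_pair ab; have := bnd_pair uv => /=; lia.
pose X := [set u; v].
have cX : #|X| = 2 by rewrite cards2 (adj_neq uv).
have bnd_uv := bnd_pair uv.
have pair_le Y : (exists a b, adj a b /\ Y = [set a; b]) -> #|bnd X| <= #|bnd Y|.
  by move=> [a [b [ab ->]]]; apply: (umin (a, b)).
have triple Y : #|Y| = 3 -> extra_edge_cut 1 (bnd Y) -> #|bnd X| < #|bnd Y|.
  move=> Y3 cY; have [|a [b [c [ab bc ac EY]]]] := path3 Y3.
    by move=> w wY; have [z [wz zY]] := extra_cut_nbr w (ltn0Sn _) cY; exists z; rewrite // zY wY.
  (* Mantel gives [inner Y <= 4]. One of [a], [c] has degree at least 3, and the other two vertices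
     form an edge, so d(Y) >= (deg u + deg v) + 3 - 4 > d(X). *)
  have := bnd_inner Y; rewrite {3}EY -setUA !big_setU1 ?big_set1 ?inE ?negb_or ?ac ?(adj_neq ab) ?(adj_neq bc) //=.
  have := mantel Y tf; rewrite Y3; have := bnd_pair uv; rewrite -/X.
  have := pmin _ _ ab; have := pmin _ _ bc; have := Hdeg _ _ _ ab bc ac.
  by move: (deg a) (deg b) (deg c) (deg u + deg v) #|bnd X| => p q r s t; lia.
apply: (super_lambda_criterion (X0 := X)) => //.
- apply: (@induced_star_connected _ u); first by rewrite !inE eqxx.
  by move=> x /set2P[]->; rewrite ?eqxx.
- apply: extra_cut_edge => // [x|w a b wa ab wb E].
    by have [z xz] := nb x; apply/card_gt0P; exists z; rewrite inE.
  (* Minimality against the edge [wa] would give deg b <= 1, the degree condition deg b > 3. *)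
  apply/eqP=> dw; have := bnd_pair ab; rewrite E bnd_uv => Edeg.
  by have := Hdeg _ _ _ wa ab wb; have := pmin _ _ wa; lia.
- by move=> Y Y2 /(connected_pair Y2)/pair_le.
- by move=> Y Y2 /(extra_cut_pair Y2)/pair_le.
move=> Y Y2 Y2' cY.
have [E|ne] := eqVneq #|Y| 3; first exact: triple.
have [E|ne'] := eqVneq #|~: Y| 3; first by rewrite -(bndC Y); apply: triple; rewrite ?bndC.
have [||a [b [ab lt]]] := Hbig Y; rewrite 1?ltn_neqAle 1?eq_sym ?ne ?ne' //.
by have := pmin _ _ ab; have := bnd_pair uv; rewrite -/X; lia.
Qed.

End Graph.

(** * Boundaries and degrees after deleting edges *)

Section DelEdges.
Variables (G : sgraph) (F : {set {set G}}).
Let H := del_edges F.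

Lemma bnd_del (X : {set G}) : #|bnd X| <= #|bnd (X : {set H})| + #|F|.
Proof.
rewrite -(cardsID F (bnd X)) addnC; apply: leq_add; last exact/subset_leq_card/subsetIr.
apply: subset_leq_card; apply/subsetP=> e; rewrite in_setD => /andP[eF].
case/bndP=> [x [y [xy xX yX E]]]; rewrite E (@in_bnd H) xX (negPf yX) andbT.
by rewrite /= /del_adj /= xy -E.
Qed.

Lemma deg_del (x : G) : deg (x : H) <= deg x.
Proof. by apply: subset_leq_card; apply/subsetP=> y; rewrite !inE => /andP[]. Qed.

Lemma triangle_free_del : triangle_free G -> triangle_free H.
Proof.
move=> tf x y z; apply: contra (tf x y z).
by case/and3P=> /andP[-> _] /andP[-> _] /andP[-> _].
Qed.

End DelEdges.

(** The summand [#|Y|] will be paid by matching edges. For |Y| > 3, a set with |Y| >= 2k - 2 uses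
    lambda' >= k + 2 and a smaller one uses Mantel. *)
Lemma side_bound (G : sgraph) k (Y : {set G}) :
  triangle_free G -> regular G k -> 0 < k -> 3 * k <= #|G| -> k + 2 <= lambda 1 G ->
  [/\ 0 < #|Y| -> 0 < #|~: Y| -> k <= #|bnd Y|,
      1 < #|Y| -> 1 < #|~: Y| -> lambda 1 G <= #|bnd Y|,
      #|Y| = 3 -> 3 * k <= #|bnd Y| + #|Y| + 1
    & 3 < #|Y| -> 3 * k <= #|bnd Y| + #|Y|].
Proof.
move=> tf rg k0 n3 la.
have hL (Z : {set G}) : 1 < #|Z| -> 1 < #|~: Z| -> lambda 1 G <= #|bnd Z|.
  by move=> *; apply: (bnd_ge_lambda1 (r := k)) => //; lia.
have hS (Z : {set G}) : #|Z| = 1 -> k <= #|bnd Z|.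
  by move=> Z1; have := bnd_regular_ge Z tf rg; rewrite Z1; lia.
have le : lambda 1 G <= 2 * k - 2 by apply: regular_lambda1_le => //; lia.
have cY := cardsC Y.
have Ycs : #|~: Y| = 1 -> k <= #|bnd Y| by move=> E; rewrite -bndC; apply: hS.
have hk : 0 < #|Y| -> 0 < #|~: Y| -> k <= #|bnd Y|.
  move=> Y0 Y0'; have := hS Y; have := hL Y; lia.
split=> //; first exact: hL.
  by move=> Y3; have := bnd_regular_ge Y tf rg; rewrite Y3; lia.
move=> Y4; have [Yc|Yc] := leqP #|~: Y| 1; first by have := hk; lia.
have := hL Y (ltnW (ltnW Y4)) Yc; have [big|small] := leqP (2 * k - 2) #|Y|; first lia.
have := bnd_regular_ge Y tf rg; move: small Y4 le la.
move: #|Y| #|bnd Y| => m d small m4 le la L1.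
(* Mantel now reads 2(d + m) >= (p + 4)(q + 4), and this is at least 6k because k >= 4 gives p + q =
   2k - 6 >= 2. *)
have [p Em] : exists p, m = p + 4 by exists (m - 4); lia.
have [q Eq] : exists q, 2 * k = q + m + 2 by exists (2 * k - 2 - m); lia.
nia.
Qed.

(** * Boundaries in the matching graph *)

(** Here [p], [q] are the sizes of X on the two sides and [dp], [dq] the boundaries inside them. If
    [p] is 0, then q > 3 and [dq + q] suffices; if [p] is 1, its k boundary edges enter as well. *)
Lemma small_side k d p dp q dq :
  (0 < p -> k <= dp) -> (q = 3 -> 3 * k <= dq + q + 1) -> (3 < q -> 3 * k <= dq + q) ->
  dp + dq + q <= d + p -> 3 < p + q -> p <= 1 -> 3 * k <= d.
Proof. by case: p => [|[|p]]; lia. Qed.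

Section Matching.
Variables (G0 G1 : sgraph) (M : G0 -> G1) (g : G1 -> G0).
Hypotheses (MK : cancel M g) (gK : cancel g M).
Let G := matching_graph M.

Lemma regular_matching k : regular G0 k -> regular G1 k -> regular G k.+1.
Proof.
move=> r0 r1 [x|y].
  have -> : [set u | @adj G (inl x) u] = inr (M x) |: inl @: [set z | adj x z].
    apply/setP=> -[z|z]; rewrite !inE /=.
      by rewrite (mem_imset _ _ (@inl_inj _ _)) inE.
    rewrite eq_sym (inj_eq (@inr_inj _ _)) [RHS]orbC.
    by case: imsetP => // -[].
  rewrite cardsU1 card_imset ?r0; last exact: inl_inj.
  by rewrite (_ : _ \notin _) //; apply/imsetP=> -[].
have -> : [set u | @adj G (inr y) u] = inl (g y) |: inr @: [set z | adj y z].
  apply/setP=> -[z|z]; rewrite !inE /=.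
    rewrite (inj_eq (@inl_inj _ _)) (can2_eq MK gK) [RHS]orbC.
    by case: imsetP => // -[].
  by rewrite (mem_imset _ _ (@inr_inj _ _)) inE.
rewrite cardsU1 card_imset ?r1; last exact: inr_inj.
by rewrite (_ : _ \notin _) //; apply/imsetP=> -[].
Qed.

(** A triangle meeting both sides would contain two matching edges with a common end. *)
Lemma triangle_free_matching : triangle_free G0 -> triangle_free G1 -> triangle_free G.
Proof.
have Minj := can_inj MK.
move=> t0 t1 [x|x] [y|y] [z|z] //=; try exact: t0; try exact: t1;
  apply/negP => /and3P[].
- by move=> xy /eqP <-; rewrite (inj_eq Minj) => /eqP E; rewrite E adj_irr in xy.
- by move=> /eqP <-; rewrite (inj_eq Minj) => /eqP -> ; rewrite adj_irr.
- by move=> /eqP <- h /eqP E; rewrite E adj_irr in h.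
- by move=> /eqP <- h; rewrite (inj_eq Minj) => /eqP E; rewrite E adj_irr in h.
- by move=> /eqP <- /eqP <-; rewrite adj_irr.
- by move=> h /eqP E1 /eqP E2; rewrite -E1 -E2 adj_irr in h.
Qed.

Section Sides.
Variable X : {set G}.
Definition side0 : {set G0} := [set x | inl x \in X].
Definition side1 : {set G1} := [set y | inr y \in X].

Lemma card_sides : #|X| = #|side0| + #|side1|.
Proof.
rewrite -!sum1_card big_sumType /=.
by congr (_ + _); apply: eq_bigl => x; rewrite inE.
Qed.

(** The matching edge at a vertex of [side1] leaves X unless its other end is in [side0], so at
    least |side1| - |side0| of them cross. The opposite difference comes from the complement of
    X. *)
Lemma bnd_sides : #|bnd side0| + #|bnd side1| + #|side1| <= #|bnd X| + #|side0|.
Proof.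
rewrite !bnd_sum [X in _ <= X + _]big_sumType.
have le0 : \sum_(x in side0) #|[set y | adj x y & y \notin side0]| <=
    \sum_(x | inl x \in X) #|[set u | @adj G (inl x) u & u \notin X]|.
  rewrite (eq_bigl (fun x => inl x \in X)); last by move=> x; rewrite inE.
  apply: leq_sum => x _; rewrite -(card_imset _ (@inl_inj G0 G1)).
  apply: subset_leq_card; apply/subsetP=> _ /imsetP[y + ->].
  by rewrite !inE.
have le1 :
    \sum_(x in side1) (#|[set y | adj x y & y \notin side1]| + (g x \notin side0)) <=
    \sum_(x | inr x \in X) #|[set u | @adj G (inr x) u & u \notin X]|.
  rewrite (eq_bigl (fun x => inr x \in X)); last by move=> x; rewrite inE.
  apply: leq_sum => x _; rewrite -(card_imset _ (@inr_inj G0 G1)).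
  set A := inr @: _; have gA : inl (g x) \notin A by apply/imsetP=> -[].
  have sA : A \subset [set u | @adj G (inr x) u & u \notin X].
    by apply/subsetP=> _ /imsetP[y + ->]; rewrite !inE.
  rewrite inE; case: (boolP (inl (g x) \in X)) => gX /=.
    by rewrite addn0 subset_leq_card.
  rewrite addn1 -add1n (_ : 1 + _ = #|inl (g x) |: A|); last by rewrite cardsU1 gA.
  by apply: subset_leq_card; rewrite subUset sA sub1set !inE /= gK eqxx gX.
have le2 : #|side1| <= \sum_(x in side1) (g x \notin side0 : nat) + #|side0|.
  rewrite -(cardsID (g @^-1: side0) side1) addnC; apply: leq_add.
    rewrite -big_mkcondr sum1dep_card /=. apply: subset_leq_card.
    by apply/subsetP=> y; rewrite !inE andbC.
  rewrite -(card_imset _ (can_inj gK)); apply: subset_leq_card.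
  by apply/subsetP=> _ /imsetP[y + ->]; rewrite !inE => /andP[].
rewrite big_split /= in le1.
apply: leq_trans (leq_add (leq_add le0 (leqnn _)) le2) _.
by rewrite addnA leq_add2r -addnA leq_add2l.
Qed.

End Sides.

Lemma side0C (X : {set G}) : side0 (~: X) = ~: side0 X.
Proof. by apply/setP=> x; rewrite !inE. Qed.

Lemma side1C (X : {set G}) : side1 (~: X) = ~: side1 X.
Proof. by apply/setP=> x; rewrite !inE. Qed.

Lemma bnd_matching_ge k (X : {set G}) :
  regular G0 k -> regular G1 k -> triangle_free G0 -> triangle_free G1 ->
  0 < k -> 3 * k <= #|G0| -> 3 * k <= #|G1| -> 3 * k <= lambda 1 G0 + lambda 1 G1 ->
  #|G0| = #|G1| ->
  3 < #|X| -> 3 < #|~: X| -> 3 * k <= #|bnd X|.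
Proof.
move=> r0 r1 t0 t1 k0 n0 n1 la En.
have le0 : lambda 1 G0 <= 2 * k - 2 by apply: regular_lambda1_le => //; lia.
have le1 : lambda 1 G1 <= 2 * k - 2 by apply: regular_lambda1_le => //; lia.
(* k + 2 = 3k - (2k - 2). *)
have la0 : k + 2 <= lambda 1 G0 by lia.
have la1 : k + 2 <= lambda 1 G1 by lia.
have D1 := bnd_sides X; have D2 := bnd_sides (~: X).
have Ea := cardsC (side0 X); have Eb := cardsC (side1 X).
rewrite !card_sides => X4 X4'; rewrite side0C side1C !bndC in D2 X4'.
have A := side_bound (side0 X) t0 r0 k0 n0 la0.
have A' := side_bound (~: side0 X) t0 r0 k0 n0 la0.
have B := side_bound (side1 X) t1 r1 k0 n1 la1.
have B' := side_bound (~: side1 X) t1 r1 k0 n1 la1.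
rewrite !bndC ?setCK in A' B'.
move: #|bnd (side0 X)| #|bnd (side1 X)| #|bnd X| #|side0 X| #|side1 X|
  #|~: side0 X| #|~: side1 X| Ea Eb D1 D2 X4 X4' A A' B B'.
move=> d0 d1 d a b a' b' Ea Eb D1 D2 X4 X4' A A' B B'.
(* Since both sides have the same order, the estimate for the complement becomes the opposite
   difference for X. *)
have D3 : d1 + d0 + a <= d + b by lia.
have D4 : d1 + d0 + a' <= d + b' by lia.
(* First the cases where X or its complement has at most one vertex on some side. *)
have [ha|ha] := leqP a 1.
  have a'0 : 0 < a' by lia.
  by case: A B => A1 _ _ _ [_ _ B3 B4]; apply: small_side D1 X4 ha => // /A1; apply.
have [hb|hb] := leqP b 1.
  have b'0 : 0 < b' by lia.
  rewrite addnC in X4.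
  by case: A B => _ _ A3 A4 [B1 _ _ _]; apply: small_side D3 X4 hb => // /B1; apply.
have [ha'|ha'] := leqP a' 1.
  have a0 : 0 < a by lia.
  by case: A' B' => A1 _ _ _ [_ _ B3 B4]; apply: small_side D2 X4' ha' => // /A1; apply.
have [hb'|hb'] := leqP b' 1.
  have b0 : 0 < b by lia.
  rewrite addnC in X4'.
  by case: A' B' => _ _ A3 A4 [B1 _ _ _]; apply: small_side D4 X4' hb' => // /B1; apply.
case: A B => _ A2 _ _ [_ B2 _ _]; have := A2 ha ha'; have := B2 hb hb'.
by clear A' B' A2 B2; lia.
Qed.

End Matching.

(** * Super-connectivity and persistence *)

(** Having a cut provides two distinct vertices, and connectedness an edge at one of them. *)
Lemma regular_super_lambda_gt0 (G : sgraph) h k :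
  super_lambda h G -> regular G k -> 0 < k.
Proof.
case/andP=> /andP[/andP[cG /existsP[F /extra_cut_elim[_ [x [y xy]] _]]] _] _ rg.
have [|z xz] := @connected_deg G x y cG.
  by apply: contraNneq xy => <-; apply: comp_refl.
by rewrite -(rg x); apply/card_gt0P; exists z; rewrite inE.
Qed.

(** * The boundary of a path on three vertices *)

Section PathCut.
Variables (G : sgraph) (x y z : G).
Hypotheses (xy : adj x y) (yz : adj y z) (xz : x != z).
Let P : {set G} := [set x; y; z].

Lemma card_path3 : #|P| = 3.
Proof. by rewrite /P -setUA cardsU1 cards2 !inE negb_or (adj_neq xy) xz (adj_neq yz). Qed.

(** The 4 counts the ends of [xy] and [yz]; a chord [xz] would only lower the boundary. *)
Lemma bnd_path3 : #|bnd P| + 4 <= deg x + deg y + deg z.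
Proof.
have := bnd_inner P; rewrite /inner /P -setUA !big_setU1 ?inE ?negb_or ?xz ?(adj_neq xy) ?(adj_neq yz) //=.
rewrite !big_set1.
set A := [set _ in _ | adj x _]; set B := [set _ in _ | adj y _]; set C := [set _ in _ | adj z _].
have A1 : 0 < #|A| by apply/card_gt0P; exists y; rewrite !inE eqxx orbT xy.
have C1 : 0 < #|C| by apply/card_gt0P; exists y; rewrite !inE eqxx orbT adj_sym yz.
have B2 : 1 < #|B|.
  by apply/card_gt1P; exists x, z; rewrite !inE !eqxx !orbT (adj_sym y x) xy yz.
by move: #|A| #|B| #|C| A1 B2 C1 => a b c; lia.
Qed.

Lemma connected_path3 : connected (induced P).
Proof.
apply: (@induced_star_connected _ _ y); first by rewrite !inE eqxx orbT.
by move=> w; rewrite !inE -orbA => /or3P[] /eqP ->; rewrite ?eqxx // adj_sym.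
Qed.

(** A vertex outside P has at most three neighbours in P, hence at least two outside, which stay in
    its component. *)
Lemma extra_cut_path3 : 3 < #|G| -> (forall w : G, 4 < deg w) ->
  extra_edge_cut 2 (bnd P).
Proof.
move=> G3 dG; have [w wP] : exists w, w \notin P by apply: subset_out; rewrite card_path3.
have xP : x \in P by rewrite !inE eqxx.
have yP : y \in P by rewrite !inE eqxx orbT.
apply: (@extra_cut_intro _ _ _ x w); first exact: bnd_edges.
  by apply: contra wP; apply: subsetP; apply: comp_closed.
have cy v : v \in P -> connect (del_adj (bnd P)) y v.
  move=> vP; have [->|vy] := eqVneq v y; first exact: connect0.
  have yv : adj y v.
    by move: vP vy; rewrite !inE -orbA => /or3P[] /eqP ->; rewrite ?eqxx // adj_sym.
  by apply: connect1; rewrite /del_adj /= yv in_bnd yP vP andbF.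
move=> v; have [vP|vP] := boolP (v \in P).
  rewrite -card_path3 subset_leq_card //; apply/subsetP=> u uP; rewrite inE.
  by apply: connect_trans (cy u uP); rewrite del_connect_sym cy.
apply: comp_card_nbrs; rewrite (negPf vP).
have := cardsID P [set u | adj v u]; have := dG v; rewrite /deg => dv.
have := subset_leq_card (subsetIr [set u | adj v u] P); rewrite card_path3.
rewrite (_ : _ :\: P = [set u | adj v u & (u \in P) == false]); first lia.
by apply/setP=> u; rewrite in_setD !in_set eqbF_neg andbC.
Qed.

End PathCut.

Lemma bnd_nonadj_pair (G : sgraph) (x y : G) : x != y -> ~~ adj x y ->
  #|bnd [set x; y]| = deg x + deg y.
Proof.
move=> nxy xy; have := bnd_inner [set x; y].
rewrite /inner !big_setU1 ?inE //= !big_set1.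
have E (w : G) : w \in [set x; y] -> [set v in [set x; y] | adj w v] = set0.
  move=> wP; apply/setP=> v; rewrite in_set in_set0; apply/negP=> /andP[vP wv].
  case/set2P: wP wv => ->; case/set2P: vP => ->;
    by rewrite ?adj_irr // ?(adj_sym y) (negPf xy).
by rewrite !E ?set21 ?set22 // !cards0 !addn0.
Qed.

(** * Consequences of the lower bound 3k on boundaries *)

Section SuperMatching.
Variables (G : sgraph) (k : nat).
Hypotheses (k4 : 3 < k) (G4 : 3 < #|G|).
Hypotheses (tf : triangle_free G) (rg : regular G k.+1).
Hypothesis big : forall X : {set G}, 3 < #|X| -> 3 < #|~: X| -> 3 * k <= #|bnd X|.

Let degG (x : G) : deg x = k.+1. Proof. exact: rg. Qed.

(** Mantel handles the case of at most three vertices on one side, [big] the rest. Thus deleting k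
    edges cannot disconnect G. *)
Lemma bnd_degree_le (X : {set G}) : X != set0 -> X != setT -> k < #|bnd X|.
Proof.
have small (Y : {set G}) : 0 < #|Y| -> #|Y| <= 3 -> k < #|bnd Y|.
  move=> Y0 Y3; have := bnd_regular_ge Y tf rg.
  by move: Y0 Y3; case: #|Y| => [|[|[|[|m]]]] //; lia.
move=> X0 XT; have [X3|X3] := leqP #|X| 3; first by apply: small; rewrite ?card_gt0.
have [X3'|X3'] := leqP #|~: X| 3; last by have := big X3 X3'; lia.
rewrite -bndC; apply: small => //; rewrite card_gt0.
by apply: contra XT => /eqP E; rewrite -(setCK X) E setC0.
Qed.

Lemma connected_super : connected G.
Proof. by apply: connected_bnd_gt0 => X X0 XT; have := bnd_degree_le X0 XT; lia. Qed.

Lemma super_lambda2 : super_lambda 2 G.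
Proof.
have /card_gt0P[y _] : 0 < #|G| by lia.
have /card_gt1P[x [z [yx yz xz]]] : 1 < #|[set x | adj y x]| by rewrite rg; lia.
rewrite inE adj_sym in yx; rewrite inE in yz.
have P3 := card_path3 yx yz xz.
have bP : #|bnd [set x; y; z]| <= 3 * k - 1.
  by have := bnd_path3 yx yz xz; rewrite !degG; lia.
(* Mantel gives 2 d(X) >= 6k - 3, and integrality raises this to d(X) >= 3k - 1. *)
have ge3 (X : {set G}) : #|X| = 3 -> #|bnd [set x; y; z]| <= #|bnd X|.
  by move=> X3; have := bnd_regular_ge X tf rg; rewrite X3; lia.
apply: (super_lambda_criterion (X0 := [set x; y; z])) => //.
- exact: connected_super.
- exact: connected_path3.
- by apply: extra_cut_path3 => // w; rewrite degG; lia.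
- by move=> X X3 _; apply: ge3.
- by move=> X X3 _; apply: ge3.
by move=> X X3 X3' _; have := big X3 X3'; lia.
Qed.

Lemma super_lambda1 : super_lambda 1 G.
Proof.
apply: super_lambda1_criterion => //; first exact: connected_super.
- exact: ltnW.
- by move=> x y z _ _ _; rewrite !degG; lia.
move=> X X3 X3'; have /card_gt0P[x _] : 0 < #|G| by lia.
have /card_gt0P[y xy] : 0 < #|[set y | adj x y]| by rewrite rg.
rewrite inE in xy; exists x, y; split=> //.
by have := big X3 X3'; rewrite !degG; lia.
Qed.

Lemma super_lambda1_del (F : {set {set G}}) : F \subset edges G -> #|F| <= k ->
  super_lambda 1 (del_edges F).
Proof.
move=> FE Fk; pose H := del_edges F.
have bH (X : {set H}) : X != set0 -> X != setT -> 0 < #|bnd X|.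
  move=> X0 XT; suff : k < #|bnd X| + #|F| by move: #|bnd X| => b; lia.
  exact: leq_trans (bnd_degree_le X0 XT) (bnd_del F X).
have cH : connected H := connected_bnd_gt0 bH.
have degH (x : H) : deg x <= k.+1 by rewrite -(degG x) deg_del.
have nbH (x : H) : exists y : H, adj x y.
  have [y] : exists y, y \notin [set x] by apply: subset_out; rewrite cards1 ltnW // ltnW.
  by rewrite inE eq_sym => /(connected_deg cH).
apply: super_lambda1_criterion => //.
- exact: triangle_free_del.
- exact: ltnW.
- move=> x y z /andP[xy _] /andP[yz _] xz.
  have nxz : ~~ @adj G x z by have := tf x y z; rewrite xy yz /= adj_sym.
  have nxzH : ~~ @adj H x z by apply: contra nxz => /andP[].
  (* At most k of the 2k + 2 edges leaving {x, z} are deleted, so the remaining degrees sum to at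
     least k + 2. *)
  have := bnd_del F [set x; z]; rewrite (@bnd_nonadj_pair G x z xz nxz) !degG.
  by rewrite (@bnd_nonadj_pair H x z xz nxzH); move: (deg _) (deg _) => p q; lia.
move=> X X3 X3'; have bX : 3 * k <= #|bnd X| + #|F| := leq_trans (big X3 X3') (bnd_del F X).
move: #|bnd X| bX => d bX.
have [F0|[e eF]] := set_0Vmem F.
  have /card_gt0P[x _] : 0 < #|G| by lia.
  have [y xy] := nbH x; exists x, y; split=> //.
  by rewrite F0 cards0 in bX; apply: leq_ltn_trans (leq_add (degH x) (degH y)) _; lia.
(* An end [x] of a deleted edge keeps degree at most k, so the degree sum along [xy] is at most 2k +
   1, below d + 2 since d >= 2k. *)
have [x [z [xz E]]] := edgesP (subsetP FE _ eF).
have [y xy] := nbH x; exists x, y; split=> //.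
have lt : deg (x : H) < deg (x : G).
  apply: proper_card; apply/properP; split.
    by apply/subsetP=> u; rewrite !inE => /andP[].
  by exists z; rewrite !inE //= /del_adj /= -E eF andbF.
by rewrite degG in lt; apply: leq_trans (leq_add lt (degH y)) _; lia.
Qed.

Lemma persistence_eq_degree : persistence_eq G k.
Proof.
split; first exact: super_lambda1.
  exact: super_lambda1_del.
move=> m ft; rewrite leqNgt; apply/negP=> km.
have /card_gt0P[v _] : 0 < #|G| by lia.
have [w] : exists w, w \notin [set v] by apply: subset_out; rewrite cards1; lia.
rewrite inE eq_sym => vw.
have := ft (bnd [set v]) (bnd_edges _); rewrite bnd1 degG => /(_ km).
case/andP=> /andP[/andP[cH _] _] _.
have [z /andP[vz]] := @connected_deg (del_edges (bnd [set v])) v w cH vw.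
by rewrite in_bnd vz !inE eqxx eq_sym (negPf (adj_neq vz)).
Qed.

End SuperMatching.

Theorem theorem4p3 (k n : nat) (G0 G1 : sgraph) (M : G0 -> G1)
  (order0 : #|G0| = n) (order1 : #|G1| = n)
  (regular0 : regular G0 k) (regular1 : regular G1 k)
  (triangle_free0 : triangle_free G0) (triangle_free1 : triangle_free G1)
  (super0 : super_lambda 0 G0) (super1 : super_lambda 0 G1)
  (perfect_M : bijective M)
  (bound : 3 * k < minn n (lambda 1 G0 + lambda 1 G1) + 1) :
  super_lambda 2 (matching_graph M) /\ persistence_eq (matching_graph M) k.
Proof.
have k0 := regular_super_lambda_gt0 super0 regular0.
case: perfect_M => g MK gK.
have [n3 la] : 3 * k <= n /\ 3 * k <= lambda 1 G0 + lambda 1 G1 by lia.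
have le0 : lambda 1 G0 <= 2 * k - 2 by apply: regular_lambda1_le => //; lia.
have le1 : lambda 1 G1 <= 2 * k - 2 by apply: regular_lambda1_le => //; lia.
(* From 3k <= 2(2k - 2). *)
have k4 : 3 < k by lia.
have tf := triangle_free_matching MK triangle_free0 triangle_free1.
have rg := regular_matching MK gK regular0 regular1.
have G4 : 3 < #|matching_graph M| by rewrite card_sum order0; lia.
have big (X : {set matching_graph M}) : 3 < #|X| -> 3 < #|~: X| -> 3 * k <= #|bnd X|.
  by apply: (bnd_matching_ge gK) => //; rewrite ?order0 ?order1.
split; first exact: super_lambda2 k4 G4 tf rg big.
exact: persistence_eq_degree k4 G4 tf rg big.
Qed.
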